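(* Let $\phi\in\Gamma_0(\mathbb{R}^m)$ be Legendre and super-coercive and let $f:\mathbb{R}^m\to\overline{\mathbb{R}}$ be proper, lsc, prox-bounded relative to $\phi$ with threshold $\lambda_f$, and finite at $\bar x\in\operatorname{int}(\operatorname{dom}\phi)$. Let $\bar v\in\mathbb{R}^m$. Then the following conditions are equivalent: (i) $f$ is relatively prox-regular (relative to $\phi$) at $\bar x$ for $\bar v$. (ii) $\bar v\in\partial f(\bar x)$ is a relatively proximal subgradient of $f$ at $\bar x$ (relative to $\phi$) and $\partial f$ has an $f$-attentive $\epsilon$-localization $T:\mathbb{R}^m\rightrightarrows\mathbb{R}^m$ around $(\bar x,\bar v)$ such that $T+r\nabla\phi$ is monotone for some $r>0$. (iii) $\bar v\in\partial f(\bar x)$, and for $\lambda\in\,]0,\lambda_f[$ sufficiently small it holds that $\overleftarrow{\operatorname{prox}}^{\phi}_{\lambda}f$ is a single-valued map near the point $\bar y:=\nabla\phi^*(\nabla\phi(\bar x)+\lambda\bar v)$ such that $\{\bar x\}=\overleftarrow{\operatorname{prox}}^{\phi}_{\lambda}f(\bar y)$ and $$\overleftarrow{\operatorname{prox}}^{\phi}_{\lambda}f(y)=\big((\nabla\phi+\lambda T)^{-1}\circ\nabla\phi\big)(y)$$ for some $f$-attentive $\epsilon$-localization $T:\mathbb{R}^m\rightrightarrows\mathbb{R}^m$ of $\partial f$ around $(\bar x,\bar v)$ and all $y$ near $\bar y$.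
   Context: $\overline{\mathbb{R}}=\mathbb{R}\cup\{-\infty,\infty\}$; $\Gamma_0(\mathbb{R}^m)$ is the set of proper lsc convex functions $\mathbb{R}^m\to\overline{\mathbb{R}}$. $\phi\in\Gamma_0(\mathbb{R}^m)$ is Legendre if it is essentially smooth (i.e. $\operatorname{int}(\operatorname{dom}\phi)\neq\emptyset$, $\phi$ is differentiable on $\operatorname{int}(\operatorname{dom}\phi)$, and $\|\nabla\phi(x^\nu)\|\to\infty$ whenever $x^\nu\to x\in\operatorname{bdry}\operatorname{dom}\phi$) and essentially strictly convex (strictly convex on every convex subset of $\operatorname{dom}\partial\phi$). Then $\nabla\phi:\operatorname{int}(\operatorname{dom}\phi)\to\operatorname{int}(\operatorname{dom}\phi^* )$ is a bijection with inverse $\nabla\phi^*$, where $\phi^*$ is the convex conjugate. Super-coercive means $\phi(x)/\|x\|\to\infty$ as $\|x\|\to\infty$ (equivalently $\operatorname{dom}\phi^*=\mathbb{R}^m$). Bregman distance: $D_\phi(x,y)=\phi(x)-\phi(y)-\langle\nabla\phi(y),x-y\rangle$ if $y\in\operatorname{int}(\operatorname{dom}\phi)$ and $+\infty$ otherwise. For $\lambda>0$: left envelope $\overleftarrow{\operatorname{env}}^{\phi}_{\lambda}f(y)=\inf_{x\in\mathbb{R}^m} f(x)+\frac1\lambda D_\phi(x,y)$ and left prox $\overleftarrow{\operatorname{prox}}^{\phi}_{\lambda}f(y)=\operatorname{argmin}_{x\in\mathbb{R}^m} f(x)+\frac1\lambda D_\phi(x,y)$. $f$ is prox-bounded relative to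 $\phi$ if there is $\lambda>0$ with $\overleftarrow{\operatorname{env}}^{\phi}_{\lambda}f(y)>-\infty$ for some $y\in\operatorname{int}(\operatorname{dom}\phi)$; the threshold $\lambda_f$ is the supremum of all such $\lambda$. $\partial f$ is the limiting (Mordukhovich) subdifferential. $v$ is a relatively proximal subgradient of $f$ at $\bar x\in\operatorname{int}(\operatorname{dom}\phi)$, where $f(\bar x)$ is finite, if there are $r>0,\epsilon>0$ such that for all $\|x-\bar x\|\le\epsilon$ one has $x\in\operatorname{int}(\operatorname{dom}\phi)$ and $f(x)\ge f(\bar x)+\langle v,x-\bar x\rangle-rD_\phi(x,\bar x)$. $f$ is locally lsc at $\bar x$ (a point where $f$ is finite) if there is $\epsilon>0$ such that all sets $\{x:\|x-\bar x\|\le\epsilon,\ f(x)\le\alpha\}$ with $\alpha\le f(\bar x)+\epsilon$ are closed. $f$ is relatively prox-regular at $\bar x\in\operatorname{int}(\operatorname{dom}\phi)$ for $\bar v$ if $f$ is finite and locally lsc at $\bar x$, $\bar v\in\partial f(\bar x)$, and there exist $\epsilon>0$ and $r\ge0$ such that for all $\|x'-\bar x\|<\epsilon$, $\|x-\bar x\|<\epsilon$ (with $\epsilon$ sufficiently small that $x,x'\in\operatorname{int}(\operatorname{dom}\phi)$), $f(x')\ge f(x)+\langle v,x'-x\rangle-rD_\phi(x',x)$ whenever $f(x)-f(\bar x)<\epsilon$, $v\in\partial f(x)$, $\|v-\bar v\|<\epsilon$. For $\epsilon>0$ and $\bar v\in\partial f(\bar x)$, the $f$-attentive $\epsilon$-localization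 $T$ of $\partial f$ around $(\bar x,\bar v)$ is $T(x)=\{v\in\partial f(x):\|v-\bar v\|<\epsilon\}$ if $\|x-\bar x\|<\epsilon$ and $f(x)<f(\bar x)+\epsilon$, and $T(x)=\emptyset$ otherwise. ''Sufficiently small'' means: for all sufficiently small positive values. *)

(* Defs.v *)
From HB Require Import structures.
From mathcomp Require Import all_boot all_order all_algebra.
From mathcomp Require Import all_classical all_reals all_analysis.
Set Implicit Arguments.
Unset Strict Implicit.
Unset Printing Implicit Defensive.
Import Order.TTheory GRing.Theory Num.Theory.
Import numFieldNormedType.Exports.
Local Open Scope classical_set_scope.
Local Open Scope ring_scope.

Section EuclideanSpace.
Context {R : realType} {m : nat}.
Implicit Types x y u v : 'rV[R]_m.

Definition dotp u v : R := \sum_(i < m) u 0 i * v 0 i.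

(* The library norm `|x| on 'rV[R]_m is the sup norm, so the Euclidean norm is
   introduced separately. Both induce the same topology, hence the library
   notions of limit, interior, closure and differentiability apply as such. *)
Definition enorm x : R := Num.sqrt (dotp x x).

End EuclideanSpace.

(* A set-valued mapping S : R^m => R^m is a function 'rV[R]_m -> set 'rV[R]_m,
   with S x = set0 when x is outside the domain of S. *)
Section SetValuedMaps.
Context {R : realType} {m : nat}.
Implicit Types S T : 'rV[R]_m -> set 'rV[R]_m.

Definition sv_add S T : 'rV[R]_m -> set 'rV[R]_m :=
  fun x => [set w | exists u v, [/\ S x u, T x v & w = u + v]].

Definition sv_scale (r : R) S : 'rV[R]_m -> set 'rV[R]_m :=
  fun x => [set r *: v | v in S x].

Definition sv_inv S : 'rV[R]_m -> set 'rV[R]_m := fun u => [set x | S x u].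

Definition sv_comp S T : 'rV[R]_m -> set 'rV[R]_m :=
  fun x => \bigcup_(u in T x) S u.

Definition monotone_map S :=
  forall x y u v, S x u -> S y v -> 0 <= dotp (u - v) (x - y).

Definition single_valued_near S (y0 : 'rV[R]_m) :=
  \forall y \near y0, exists x, S y = [set x].

End SetValuedMaps.

Section ExtendedRealFunctions.
Context {R : realType} {m : nat}.
Local Open Scope ereal_scope.
Implicit Types (f phi : 'rV[R]_m -> \bar R) (x y u v : 'rV[R]_m).

Definition edom f : set 'rV[R]_m := [set x | f x < +oo].

Definition proper_efun f := (forall x, -oo < f x) /\ edom f !=set0.

Definition convex_efun f := forall x y (t : R), (0 < t < 1)%R ->
  f (t *: x + (1 - t) *: y)%R <= t%:E * f x + (1 - t)%:E * f y.

Definition Gamma0 f := [/\ proper_efun f, lower_semicontinuous f & convex_efun f].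

Definition argmin f : set 'rV[R]_m :=
  [set x | f x < +oo /\ forall z, f x <= f z].

(* Gradient of the finite part of f, given by the partial derivatives; only
   meaningful at interior points of edom f where fine \o f is differentiable. *)
Definition grad f x : 'rV[R]_m :=
  (\row_i 'D_(delta_mx 0 i) (fine \o f : 'rV[R]_m -> R) x)%R.

Definition grad_map f : 'rV[R]_m -> set 'rV[R]_m :=
  fun x => [set g | (edom f)° x /\ g = grad f x].

Definition conjugate f : 'rV[R]_m -> \bar R :=
  fun v => ereal_sup (range (fun x => (dotp v x)%:E - f x)).

Definition regular_subdiff f : 'rV[R]_m -> set 'rV[R]_m := fun x =>
  [set v | f x \is a fin_num /\ forall eps : R, (0 < eps)%R ->
    \forall y \near x,
      f x + (dotp v (y - x))%:E - (eps * enorm (y - x))%:E <= f y].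

Definition limiting_subdiff f : 'rV[R]_m -> set 'rV[R]_m := fun x =>
  [set v | f x \is a fin_num /\ exists x_ v_ : nat -> 'rV[R]_m,
    [/\ x_ n @[n --> \oo] --> x, f (x_ n) @[n --> \oo] --> f x,
        v_ n @[n --> \oo] --> v &
        forall n, regular_subdiff f (x_ n) (v_ n)]].

Definition essentially_smooth phi :=
  [/\ (edom phi)° !=set0,
      forall x, (edom phi)° x ->
        differentiable (fine \o phi : 'rV[R]_m -> R) x &
      forall (x : 'rV[R]_m) (x_ : nat -> 'rV[R]_m),
        (closure (edom phi) `\` (edom phi)°) x ->
        (forall n, (edom phi)° (x_ n)) -> x_ n @[n --> \oo] --> x ->
        enorm (grad phi (x_ n)) @[n --> \oo] --> +oo%R].

Definition essentially_strictly_convex phi :=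
  forall C : set 'rV[R]_m, convex_set C ->
    C `<=` [set x | limiting_subdiff phi x !=set0] ->
    forall x y (t : R), C x -> C y -> x != y -> (0 < t < 1)%R ->
      phi (t *: x + (1 - t) *: y)%R < t%:E * phi x + (1 - t)%:E * phi y.

Definition legendre phi :=
  essentially_smooth phi /\ essentially_strictly_convex phi.

Definition super_coercive phi := forall M : R, exists rho : R,
  forall x, (rho < enorm x)%R -> M%:E <= phi x * ((enorm x)^-1)%:E.

Definition bregman phi x y : \bar R :=
  if `[< (edom phi)° y >]
  then phi x - phi y - (dotp (grad phi y) (x - y))%:E else +oo.

Definition left_env phi (lambda : R) f : 'rV[R]_m -> \bar R := fun y =>
  ereal_inf (range (fun x => f x + lambda^-1%:E * bregman phi x y)).

Definition left_prox phi (lambda : R) f : 'rV[R]_m -> set 'rV[R]_m := fun y =>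
  argmin (fun x => f x + lambda^-1%:E * bregman phi x y).

Definition prox_params phi f : set R :=
  [set lambda | (0 < lambda)%R /\
    exists y, (edom phi)° y /\ -oo < left_env phi lambda f y].

Definition prox_bounded phi f := prox_params phi f !=set0.

Definition prox_threshold phi f : \bar R :=
  ereal_sup (EFin @` prox_params phi f).

Definition rel_prox_subgrad phi f (xbar v : 'rV[R]_m) :=
  [/\ (edom phi)° xbar, f xbar \is a fin_num &
    exists r eps : R, [/\ (0 < r)%R, (0 < eps)%R &
      forall x, (enorm (x - xbar) <= eps)%R ->
        (edom phi)° x /\
        f xbar + (dotp v (x - xbar))%:E - r%:E * bregman phi x xbar <= f x]].

Definition locally_lsc f (xbar : 'rV[R]_m) :=
  f xbar \is a fin_num /\
  exists2 eps : R, (0 < eps)%R &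
    forall alpha : R, alpha%:E <= f xbar + eps%:E ->
      closed [set x | (enorm (x - xbar) <= eps)%R /\ f x <= alpha%:E].

Definition rel_prox_regular phi f (xbar vbar : 'rV[R]_m) :=
  [/\ (edom phi)° xbar, f xbar \is a fin_num, locally_lsc f xbar,
    limiting_subdiff f xbar vbar &
    exists eps r : R, [/\ (0 < eps)%R, (0 <= r)%R,
      forall x, (enorm (x - xbar) < eps)%R -> (edom phi)° x &
      forall x x' v,
        (enorm (x' - xbar) < eps)%R -> (enorm (x - xbar) < eps)%R ->
        f x - f xbar < eps%:E -> limiting_subdiff f x v ->
        (enorm (v - vbar) < eps)%R ->
        f x + (dotp v (x' - x))%:E - r%:E * bregman phi x' x <= f x']].

Definition attentive_localization f (xbar vbar : 'rV[R]_m) (eps : R) :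
    'rV[R]_m -> set 'rV[R]_m := fun x =>
  [set v | [/\ limiting_subdiff f x v, (enorm (v - vbar) < eps)%R,
               (enorm (x - xbar) < eps)%R & f x < f xbar + eps%:E]].

End ExtendedRealFunctions.

(* Main.v *)
Require Import Defs.
From HB Require Import structures.
From mathcomp Require Import all_boot all_order all_algebra.
From mathcomp Require Import all_classical all_reals all_analysis.
From mathcomp Require Import ring lra.
Import Order.TTheory GRing.Theory Num.Theory.
Import numFieldNormedType.Exports.
Local Open Scope classical_set_scope.
Local Open Scope ring_scope.

(** Write g for the gradient of phi and D for its Bregman distance. As functions
    of x, D(x, y) and phi x - <g y, x> differ by a constant, so the left
    proximal mapping at y consists of the minimizers of the tilted function
    f + (phi - <w, .>) / lambda with w = g y. The whole proof takes place in
    this dual variable w.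

    At w0 = g xbar + lambda vbar the tilted function equals, up to a constant,
    f x - <vbar, x - xbar> + D(x, xbar) / lambda. If vbar is a proximal
    subgradient with constant r < 1 / lambda, then xbar is a minimizer whose
    excess is at least a multiple of D(x, xbar), and D(x, xbar) grows linearly
    away from xbar ([rbregman_growth]). Changing w0 to a nearby w costs only a
    small multiple of |x - xbar|; therefore minimizers for w exist and stay
    close to xbar ([tilted_argmin_stable]). The same statement with f = 0 says
    that g is open at interior points ([grad_open]); hence, for small lambda,
    w0 = g ybar for an interior point ybar, and ybar is the gradient of the
    conjugate at w0 ([grad_conjugate]).

    (i) implies (ii): the prox-regularity inequality at xbar is the proximal
    inequality, and adding the inequality at (x, u) to the one at (y, v) gives
    monotonicity, because D(x, y) + D(y, x) = <g x - g y, x - y>.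

    (ii) implies (iii): prox-boundedness turns the local proximal inequality
    into a global one with a larger constant ([rel_prox_subgrad_global]), so
    the stability statement applies. For w near w0 each minimizer x is close
    to xbar, has value f x close to f xbar, and by Fermat's rule (w - g x) /
    lambda is a subgradient close to vbar: the proximal set is nonempty and
    contained in the resolvent of T ([tilted_argmin_localization]).
    Monotonicity of T + r g with lambda r < 1 makes that resolvent at most
    single-valued ([resolvent_unique]), so the two sets coincide.

    (iii) implies (i): let x be near xbar and v in T x. As g is open at ybar,
    g x + lambda v = g y for some y near ybar. Then x lies in the resolvent at
    y, so it minimizes the tilted function for w = g y, and this minimality is
    the prox-regularity inequality with constant 1 / lambda
    ([left_prox_regular]). *)

(** * The dot product and the two norms *)

Section DotProduct.
Context {R : realType} {m : nat}.
Implicit Types (x y u v w : 'rV[R]_m) (a e : R).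

Lemma dotpC u v : dotp u v = dotp v u.
Proof. by apply: eq_bigr => i _; rewrite mulrC. Qed.

Lemma dotpDl u v w : dotp (u + v) w = dotp u w + dotp v w.
Proof. by rewrite -big_split; apply: eq_bigr => i _; rewrite mxE mulrDl. Qed.

Lemma dotpDr u v w : dotp w (u + v) = dotp w u + dotp w v.
Proof. by rewrite !(dotpC w) dotpDl. Qed.

Lemma dotpZl a u v : dotp (a *: u) v = a * dotp u v.
Proof. by rewrite /dotp big_distrr /=; apply: eq_bigr => i _; rewrite mxE mulrA. Qed.

Lemma dotpNl u v : dotp (- u) v = - dotp u v.
Proof. by rewrite -scaleN1r dotpZl mulN1r. Qed.

Lemma dotpBl u v w : dotp (u - v) w = dotp u w - dotp v w.
Proof. by rewrite dotpDl dotpNl. Qed.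

Lemma dotpBr u v w : dotp w (u - v) = dotp w u - dotp w v.
Proof. by rewrite !(dotpC w) dotpBl. Qed.

Lemma dotpZr a u v : dotp v (a *: u) = a * dotp v u.
Proof. by rewrite !(dotpC v) dotpZl. Qed.

Lemma dotp0l u : dotp 0 u = 0.
Proof. by rewrite -(scale0r 0) dotpZl mul0r. Qed.

Lemma dotp_delta u i : dotp u (delta_mx 0 i) = u 0 i.
Proof.
rewrite /dotp (bigD1 i) //= mxE !eqxx mulr1 big1 ?addr0 // => j /negPf ji.
by rewrite mxE ji andbF mulr0.
Qed.

Lemma norm_coord_le x i : `|x 0 i| <= `|x|.
Proof.
rewrite [leRHS]/Num.norm /= mx_normrE; apply/bigmax_geP; right => /=.
by exists (0, i).
Qed.

Lemma norm_coordP x a : 0 <= a -> (forall i, `|x 0 i| <= a) -> `|x| <= a.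
Proof.
move=> a0 xa; rewrite [leLHS]/Num.norm /= mx_normrE; apply/bigmax_leP; split=> //=.
by case=> i j _; rewrite (ord1 i).
Qed.

(** The library norm is the sup norm, whence the factor [m]; the estimates below
    only need some constant in place of the Cauchy-Schwarz one. *)
Lemma dotp_le u v : `|dotp u v| <= m%:R * `|u| * `|v|.
Proof.
rewrite /dotp; apply: (le_trans (ler_norm_sum _ _ _)).
apply: (@le_trans _ _ (\sum_(i < m) `|u| * `|v|)); last first.
  by rewrite sumr_const card_ord -mulrA mulr_natl.
by apply: ler_sum => i _; rewrite normrM ler_pM ?norm_coord_le.
Qed.

Lemma cvg_dotp {T : Type} (F : set_system T) {FF : Filter F}
    (u_ v_ : T -> 'rV[R]_m) u v :
  u_ t @[t --> F] --> u -> v_ t @[t --> F] --> v ->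
  dotp (u_ t) (v_ t) @[t --> F] --> dotp u v.
Proof.
move=> cu cv; apply: (cvg_big (op := +%R)) => [|i _].
  exact: pseudometric_normed_Zmodule.add_continuous.
apply: cvgM.
  exact: (cvg_comp _ _ cu (@coord_continuous _ _ _ 0 i u)).
exact: (cvg_comp _ _ cv (@coord_continuous _ _ _ 0 i v)).
Qed.

Lemma cvg_subr x y : (z - y) @[z --> x] --> x - y.
Proof.
by apply: (@cvgB _ _ _ (nbhs x) _ id (fun=> y)); [exact: cvg_id|exact: cvg_cst].
Qed.

Lemma norm_le_enorm x : `|x| <= enorm x.
Proof.
apply: norm_coordP => [|i]; first exact: sqrtr_ge0.
rewrite -sqrtr_sqr ler_sqrt; last by apply: sumr_ge0 => j _; rewrite -expr2 sqr_ge0.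
rewrite /dotp (bigD1 i) //= expr2 lerDl.
by apply: sumr_ge0 => j _; rewrite -expr2 sqr_ge0.
Qed.

Lemma enorm_le x : enorm x <= m%:R * `|x|.
Proof.
rewrite -(@ger0_norm _ (m%:R * `|x|)) ?mulr_ge0 // -sqrtr_sqr.
rewrite ler_sqrt ?sqr_ge0 //; apply: le_trans (ler_norm _) _.
apply: le_trans (dotp_le _ _) _.
rewrite exprMn -mulrA -expr2 ler_wpM2r ?sqr_ge0 // -natrX ler_nat.
by case: (m) => // n; rewrite leq_pmulr.
Qed.

Lemma nbhs_distP x (P : set 'rV[R]_m) :
  nbhs x P <-> exists2 e : R, 0 < e & forall y, `|y - x| < e -> P y.
Proof.
rewrite -nbhs_nbhs_norm.
by split=> -[e e0 eP]; exists e => // y /=; rewrite distrC => /eP.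
Qed.

Lemma nbhs_enormP x (P : set 'rV[R]_m) :
  nbhs x P <-> exists2 e : R, 0 < e & forall y, enorm (y - x) < e -> P y.
Proof.
split.
  move=> /nbhs_distP[e e0 eP]; exists e => // y xy; apply: eP.
  exact: le_lt_trans (norm_le_enorm _) xy.
move=> [e e0 eP]; apply/nbhs_distP; exists (e / m.+1%:R).
  by rewrite divr_gt0.
move=> y xy; apply: eP; apply: le_lt_trans (enorm_le _) _.
apply: (@le_lt_trans _ _ (m.+1%:R * `|y - x|)).
  by rewrite ler_wpM2r // ler_nat.
by rewrite mulrC -ltr_pdivlMr.
Qed.

Lemma segment_cvg x y : (y + t *: (x - y)) @[t --> (0 : R)] --> y.
Proof.
rewrite -[X in _ --> X]addr0 -(scale0r (x - y)).
by apply: cvgD; [exact: cvg_cst|apply: cvgZr_tmp; exact: cvg_id].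
Qed.

Lemma segment_near x y (P : set 'rV[R]_m) : nbhs y P ->
  exists2 t : R, 0 < t < 1 & P (t *: x + (1 - t) *: y).
Proof.
move=> /(segment_cvg x y) Pt.
have Pt' : \forall t \near (0 : R)^'+, P (y + t *: (x - y)).
  exact: cvg_at_right_filter Pt.
have [t] : exists t : R, 0 < t < 1 /\ P (y + t *: (x - y)).
  apply: (@filter_ex _ (0 : R)^'+).
  near=> t; split; last by near: t.
  by apply/andP; split; near: t; [exact: nbhs_right_gt|exact: nbhs_right_lt].
move=> [t01 h]; exists t => //.
by rewrite scalerBl scale1r addrCA -scalerBr.
Unshelve. all: by end_near. Qed.

End DotProduct.

(** * Gradients, semicontinuity and attainment of minima *)

Section ExtendedFunctions.
Context {R : realType} {m : nat}.
Implicit Types (f phi : 'rV[R]_m -> \bar R) (x y u v w : 'rV[R]_m) (a e t : R).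

Lemma fineK_lt f x : (-oo < f x)%E -> (f x < +oo)%E -> f x = (fine (f x))%:E.
Proof. by move=> f1 f2; rewrite fineK // fin_real // f1 f2. Qed.

Lemma diff_dotp_grad f x h : differentiable (fine \o f : 'rV[R]_m -> R) x ->
  'd (fine \o f : 'rV[R]_m -> R) x h = dotp (grad f x) h.
Proof.
move=> df; rewrite [h in LHS]row_sum_delta linear_sum; apply: eq_bigr => i _.
by rewrite linearZ /= mxE deriveE // mulrC.
Qed.

Lemma grad_expansion f x e : differentiable (fine \o f : 'rV[R]_m -> R) x ->
  0 < e -> \forall y \near x,
  `|fine (f y) - fine (f x) - dotp (grad f x) (y - x)| <= e * `|y - x|.
Proof.
move=> df e0.
have /diff_locallyP[_ /eqaddoP /(_ _ e0)] := df.
rewrite [X in _ -> X](near_shift 0) subr0; apply: filterS => h /=.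
by rewrite !fctE /= diff_dotp_grad // addrK opprD addrA.
Qed.

Lemma regular_limiting f x v : regular_subdiff f x v -> limiting_subdiff f x v.
Proof.
move=> fxv; split; first by case: fxv.
by exists (fun=> x), (fun=> v); split=> //; exact: cvg_cst.
Qed.

Lemma ereal_between (a b : \bar R) : (a < b)%E ->
  exists c : R, (a < c%:E)%E /\ (c%:E < b)%E.
Proof.
case: a b => [a| |] [b| |] //=; rewrite ?lte_fin.
- by move=> ab; exists ((a + b) / 2); rewrite !lte_fin; lra.
- by move=> _; exists (a + 1); rewrite lte_fin ltry; split=> //; lra.
- by move=> _; exists (b - 1); rewrite lte_fin ltNyr; split=> //; lra.
- by move=> _; exists 0; rewrite ltNyr ltry.
Qed.

(** The sublevel sets of [f + q] on [K] at the levels above the infimum generate a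
    proper filter. At a cluster point, lower semicontinuity forbids a value above
    the infimum. *)
Lemma lsc_attains_min f (q : 'rV[R]_m -> R) (K : set 'rV[R]_m) :
  lower_semicontinuous f -> (forall x, (-oo < f x)%E) -> compact K ->
  (forall x, K x -> q z @[z --> x] --> q x) ->
  (exists2 x, K x & (f x < +oo)%E) ->
  exists x, [/\ K x, (f x < +oo)%E &
    forall z, K z -> (f z < +oo)%E -> fine (f x) + q x <= fine (f z) + q z].
Proof.
move=> f_lsc f_gt Kcompact q_cont [x0 Kx0 fx0].
pose h x := (f x + (q x)%:E)%E; pose I := ereal_inf (h @` K).
have I_le z : K z -> (I <= h z)%E by move=> Kz; apply: ereal_inf_lbound; exists z.
pose F := filter_from [set a : \bar R | (I < a)%E]
  (fun a : \bar R => [set x | K x /\ (h x < a)%E]).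
have Ioo : (I < +oo)%E.
  apply: le_lt_trans (I_le _ Kx0) _.
  by rewrite /h (fineK_lt _ _ (f_gt x0) fx0) -EFinD ltry.
have FF : ProperFilter F.
  apply: filter_from_proper.
    apply: filter_from_filter; first by exists +oo%E.
    move=> a b /= Ia Ib; exists (Order.min a b) => /=; first by rewrite lt_min Ia.
    by move=> x [Kx]; rewrite /= lt_min => /andP[xa xb].
  by move=> a /= /ereal_inf_lt[_ [x Kx <-] xa]; exists x.
have FK : F K by exists +oo%E => // x [].
have [x [Kx clx]] := Kcompact F FF FK.
have hx : (h x <= I)%E.
  rewrite leNgt; apply/negP => /ereal_between[b [Ib bx]].
  have [c [c1 c2]] : exists c : R, ((b - q x)%:E < c%:E)%E /\ (c%:E < f x)%E.
    by apply: ereal_between; rewrite EFinB lteBlDr.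
  rewrite lte_fin in c1.
  have [V Vx fV] := f_lsc _ _ c2.
  have qV : \forall z \near x, b - c < q z.
    by apply: (cvgr_gt (q x)) (q_cont _ Kx) _ _; lra.
  have Fb : F [set x | K x /\ (h x < b%:E)%E] by exists b%:E.
  have [z [[Kz hz] [Vz qz]]] := clx _ _ Fb (filterI Vx qV).
  have : (b%:E < h z)%E.
    apply: (@lt_trans _ _ (c + q z)%:E); first by rewrite lte_fin; lra.
    by rewrite EFinD lteD2rE //; exact: fV.
  by rewrite ltNge (ltW hz).
have hz z : K z -> (h x <= h z)%E by move=> /I_le; exact: le_trans hx.
have xfin : (f x < +oo)%E.
  have := hz _ Kx0; rewrite /h (fineK_lt _ _ (f_gt x0) fx0) -EFinD.
  by case: (f x) => [r| |] //; rewrite ltry.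
exists x; split=> // z Kz zfin; have := hz _ Kz.
rewrite /h (fineK_lt _ _ (f_gt x) xfin) (fineK_lt _ _ (f_gt z) zfin).
by rewrite -!EFinD lee_fin.
Qed.

(** Closed balls and spheres are the instances [C] = a half-line and [C] = a
    point. *)
Lemma shell_compact y r (C : set R) : closed C -> (forall a, C a -> a <= r) ->
  compact [set x | C `|x - y|].
Proof.
move=> Cclosed Cr; apply: bounded_closed_compact.
  exists (r + `|y|); split; first exact: num_real.
  move=> M rM x /Cr xr; apply: le_trans (ltW rM).
  rewrite -[x in `|x|](subrK y); apply: le_trans (ler_normD _ _) _.
  by rewrite lerD2r.
apply: (@preimage_closed _ _ (fun x : 'rV[R]_m => `|x - y|) _ _ Cclosed) => x _.
exact: cvg_norm (cvg_subr x y).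
Qed.

Lemma lsc_locally_lsc (f : 'rV[R]_m -> \bar R) xbar :
  lower_semicontinuous f -> f xbar \is a fin_num -> locally_lsc f xbar.
Proof.
move=> f_lsc xf; split=> //; exists 1 => // alpha _; apply: closedI.
  apply: (@preimage_closed _ _ (fun x : 'rV[R]_m => enorm (x - xbar))
    [set a : R | a <= 1]).
    move=> x _.
    have c : dotp (z - xbar) (z - xbar) @[z --> x] --> dotp (x - xbar) (x - xbar).
      by apply: (@cvg_dotp _ _ _ (nbhs x)); exact: cvg_subr.
    exact: cvg_comp c (@sqrt_continuous R _).
  exact: closed_le.
have -> : (fun x : 'rV[R]_m => (f x <= alpha%:E)%E : Prop) =
    ~` [set x | (alpha%:E < f x)%E].
  by apply/seteqP; split => x /=; rewrite leNgt => /negP.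
by apply: open_closedC; exact: (lower_semicontinuousP _).1.
Qed.

End ExtendedFunctions.

(** * Bregman distances of an essentially strictly convex function *)

Section LegendreFunction.
Context {R : realType} {m : nat} (phi : 'rV[R]_m -> \bar R).
Implicit Types (x y z u v w : 'rV[R]_m) (a e t : R).
Hypothesis phi_gt : forall x, (-oo < phi x)%E.
Hypothesis phi_convex : convex_efun phi.
Hypothesis phi_diff : forall x, (edom phi)° x ->
  differentiable (fine \o phi : 'rV[R]_m -> R) x.
Hypothesis phi_strict : essentially_strictly_convex phi.

(** The real number that [bregman phi x y] is when [y] is interior and [phi x]
    is finite ([bregmanE]), so that estimates can be carried out in [R]. *)
Definition rbregman x y : R :=
  fine (phi x) - fine (phi y) - dotp (grad phi y) (x - y).

Lemma int_edom y : (edom phi)° y -> (phi y < +oo)%E.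
Proof. exact: interior_subset. Qed.

Lemma near_int_edom y : (edom phi)° y -> \forall z \near y, (edom phi)° z.
Proof. exact: nbhs_interior. Qed.

Lemma phi_fine x : (phi x < +oo)%E -> phi x = (fine (phi x))%:E.
Proof. by apply: fineK_lt. Qed.

Lemma convex_fine x y t : (phi x < +oo)%E -> (phi y < +oo)%E -> 0 < t < 1 ->
  (phi (t *: x + (1 - t) *: y) < +oo)%E /\
  fine (phi (t *: x + (1 - t) *: y)) <= t * fine (phi x) + (1 - t) * fine (phi y).
Proof.
move=> /phi_fine px /phi_fine py t01; have h := phi_convex x y t t01.
rewrite px py -!EFinM -EFinD in h.
have h' := le_lt_trans h (ltry _); split => //.
by rewrite -lee_fin -phi_fine.
Qed.

(** By convexity the difference quotients of [phi] at [y] in the direction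
    [x - y] are at most [phi x - phi y]; the step tends to [0]. *)
Lemma rbregman_ge0 x y : (edom phi)° y -> (phi x < +oo)%E -> 0 <= rbregman x y.
Proof.
move=> Uy xfin; apply/ler_addgt0Pr => e e0.
have e1 : 0 < e / (1 + `|x - y|) by rewrite divr_gt0 // ltr_pwDl.
have [t t01 /=] := segment_near x _ _ (grad_expansion _ _ _ (phi_diff _ Uy) e1).
have [_] := convex_fine _ _ _ xfin (int_edom _ Uy) t01.
have -> : t *: x + (1 - t) *: y - y = t *: (x - y).
  by apply/rowP => i; rewrite !mxE; ring.
case/andP: t01 => t0 t1; rewrite dotpZr normrZ (gtr0_norm t0) ler_norml.
move=> h /andP[h' _].
rewrite -(ler_pM2l t0) mulr0 /rbregman.
have h3 : e / (1 + `|x - y|) * `|x - y| <= e.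
  rewrite mulrAC ler_pdivrMr ?ltr_pwDl // ler_pM2l // lerDr //.
set q := e / _ in h3 h'; have : t * (q * `|x - y|) <= t * e by rewrite ler_pM2l.
lra.
Qed.

(** For [z] near [y], the gradient inequality at [z] is tested at the points
    [z + s e_i] and [z - s e_i], where [s] exceeds the distance from [z] to [y].
    The first-order expansion of [phi] at [y] controls both values of [phi] to
    within a small multiple of [s], which bounds each coordinate of
    [grad phi z - grad phi y]. *)
Lemma grad_continuous y : (edom phi)° y -> grad phi z @[z --> y] --> grad phi y.
Proof.
move=> Uy; apply/(@cvgrPdist_le _ _ _ (nbhs y)) => /= eps eps0.
have e0 : 0 < eps / 2 by rewrite divr_gt0.
have [rho rho0 near_y] := (nbhs_distP _ _).1
  (filterI (near_int_edom _ Uy) (grad_expansion _ _ _ (phi_diff _ Uy) e0)).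
set s := rho / 4; have s0 : 0 < s by rewrite divr_gt0.
apply: (nbhs_distP _ _).2; exists s => // z zy.
(* The signs [a = 1] and [a = -1] give the two bounds on the [i]-th coordinate. *)
have test (a : R) i : `|a| = 1 -> a * (grad phi z 0 i - grad phi y 0 i) <= eps.
  move=> a1; pose q := z + (a * s) *: delta_mx 0 i.
  have qz : q - z = (a * s) *: delta_mx 0 i by rewrite addrC addKr.
  have nq : `|q - z| <= s.
    rewrite qz normrZ normrM a1 mul1r gtr0_norm // ler_piMr ?(ltW s0) //.
    apply: norm_coordP => // j; rewrite mxE /=.
    by case: eqP => _; rewrite ?normr1 ?normr0.
  have qy : `|q - y| <= 2 * s.
    rewrite (_ : q - y = (q - z) + (z - y)); last by rewrite addrA subrK.
    rewrite (le_trans (ler_normD _ _)) // mulr_natl mulr2n lerD //.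
    exact: ltW.
  have /near_y[Uq /= Eq] : `|q - y| < rho.
    by apply: le_lt_trans qy _; rewrite /s; lra.
  have /near_y[Uz _] : `|z - y| < rho by apply: lt_trans zy _; rewrite /s; lra.
  have := rbregman_ge0 _ _ Uz (int_edom _ Uq).
  have := rbregman_ge0 _ _ Uy (int_edom _ Uz).
  have : eps / 2 * `|q - y| <= eps * s.
    rewrite (_ : eps * s = eps / 2 * (2 * s)); last by field.
    by rewrite ler_pM2l.
  move: Eq; rewrite /rbregman ler_norml => /andP[_].
  have -> : q - y = (q - z) + (z - y) by rewrite addrA subrK.
  rewrite qz !dotpDr !dotpZr !dotp_delta.
  by move=> h1 h2 h3 h4; rewrite -(ler_pM2r s0); lra.
apply: norm_coordP => [|i]; first exact: ltW.
rewrite mxE [X in _ + X]mxE ler_norml.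
have := test 1 i (normr1 _); have := test (-1) i; rewrite normrN1 => /(_ erefl).
by move=> h1 h2; apply/andP; split; lra.
Qed.

(** Convex subsets of the interior of the domain thus qualify in the definition
    of essential strict convexity. *)
Lemma limiting_grad y : (edom phi)° y -> limiting_subdiff phi y (grad phi y).
Proof.
move=> Uy; apply: regular_limiting; rewrite /regular_subdiff /=.
have yfin := int_edom _ Uy.
split; first by rewrite (phi_fine _ yfin).
move=> eps eps0; near=> z.
have [zfin|] := ltP (phi z) +oo%E; last by rewrite leye_eq => /eqP ->; rewrite leey.
rewrite (phi_fine _ zfin) (phi_fine _ yfin) -EFinD lee_fin.
have := rbregman_ge0 _ _ Uy zfin.
have : 0 <= eps * enorm (z - y) by rewrite mulr_ge0 ?sqrtr_ge0 // ltW.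
rewrite /rbregman; lra.
Unshelve. all: by end_near. Qed.

(** If the distance vanished, [phi] would be affine on the segment from [y] to
    [x]; but close to [y] this segment runs inside a convex neighbourhood on
    which [phi] is strictly convex. *)
Lemma rbregman_gt0 x y :
  (edom phi)° y -> (phi x < +oo)%E -> x != y -> 0 < rbregman x y.
Proof.
move=> Uy xfin xy; have yfin := int_edom _ Uy.
have [B Bconvex [Bopen /(_ y _ (near_int_edom _ Uy))[C [BC Cy] CU]]] :=
  @locally_convex R 'rV[R]_m.
have Cnbhs : nbhs y C by apply: open_nbhs_nbhs; split => //; exact: Bopen.
have Csub : C `<=` [set z | limiting_subdiff phi z !=set0].
  by move=> z /CU Uz; exists (grad phi z); exact: limiting_grad.
have Cconvex : convex_set C by apply: Bconvex; rewrite inE.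
have [t t01 Cz] := segment_near x y C Cnbhs.
set z := _ + _ in Cz.
have zy : z - y = t *: (x - y) by apply/rowP => i; rewrite !mxE; ring.
have zNy : z != y.
  rewrite -subr_eq0 zy scaler_eq0 subr_eq0 negb_or xy andbT.
  by case/andP: t01 => /gt_eqF ->.
have half01 : 0 < (2^-1 : R) < 1 by apply/andP; split; lra.
have [zfin pz] := convex_fine _ _ _ xfin yfin t01.
have [hfin ph] := convex_fine _ _ _ zfin yfin half01.
have := phi_strict C Cconvex Csub z y 2^-1 Cz Cy zNy half01.
set h := _ + _ in hfin ph *.
rewrite (phi_fine _ zfin) (phi_fine _ yfin) (phi_fine _ hfin).
rewrite -!EFinM -EFinD lte_fin.
have := rbregman_ge0 _ _ Uy hfin; rewrite /rbregman.
have -> : h - y = 2^-1 *: (z - y) by apply/rowP => i; rewrite !mxE; lra.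
rewrite zy !dotpZr => hgap hstrict.
case/andP: t01 => t0 t1; rewrite -(ltr_pM2l t0) mulr0.
lra.
Qed.

Lemma rbregman_convex x y t : (phi y < +oo)%E -> (phi x < +oo)%E -> 0 < t < 1 ->
  rbregman (t *: x + (1 - t) *: y) y <= t * rbregman x y.
Proof.
move=> yfin xfin t01; have [_] := convex_fine _ _ _ xfin yfin t01.
rewrite /rbregman (_ : t *: x + (1 - t) *: y - y = t *: (x - y)); last first.
  by apply/rowP => i; rewrite !mxE; ring.
by rewrite dotpZr; lra.
Qed.

Lemma rbregman_continuous x y :
  (edom phi)° x -> rbregman z y @[z --> x] --> rbregman x y.
Proof.
move=> Ux; apply: (@cvgB _ _ _ (nbhs x)).
  apply: (@cvgB _ _ _ (nbhs x)); last exact: cvg_cst.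
  exact: differentiable_continuous (phi_diff _ Ux).
by apply: (@cvg_dotp _ _ _ (nbhs x)); [exact: cvg_cst|exact: cvg_subr].
Qed.

(** On a small sphere around [y] the distance is continuous and positive, hence
    bounded below; as it is convex along the rays from [y] and vanishes at
    [y], the bound scales at least linearly beyond the sphere. *)
Lemma rbregman_growth y e : (edom phi)° y -> 0 < e ->
  exists2 a, 0 < a &
    forall x, (phi x < +oo)%E -> e <= `|x - y| -> a * `|x - y| <= rbregman x y.
Proof.
move=> Uy e0; have yfin := int_edom _ Uy.
have [rho rho0 near_y] := (nbhs_distP _ _).1 (near_int_edom _ Uy).
pose s := Num.min e rho / 2.
have s0 : 0 < s by rewrite divr_gt0 // lt_min e0.
have se : s < e by rewrite ltr_pdivrMr // gt_min; apply/orP; left; lra.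
have srho : s < rho by rewrite ltr_pdivrMr // gt_min; apply/orP; right; lra.
pose K := [set x : 'rV[R]_m | `|x - y| = s].
have KU x : K x -> (edom phi)° x by move=> xs; apply: near_y; rewrite xs.
have proj x : (phi x < +oo)%E -> e <= `|x - y| ->
    exists2 z, K z & s * rbregman x y >= `|x - y| * rbregman z y.
  move=> xfin ex; have n0 : 0 < `|x - y| by apply: lt_le_trans ex.
  pose t := s / `|x - y|.
  have t01 : 0 < t < 1.
    by rewrite divr_gt0 //= ltr_pdivrMr // mul1r (lt_le_trans se).
  exists (t *: x + (1 - t) *: y); last first.
    by rewrite mulrC -ler_pdivlMr // mulrAC; exact: rbregman_convex.
  rewrite /K /= (_ : _ - y = t *: (x - y)); last first.
    by apply/rowP => i; rewrite !mxE; ring.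
  by case/andP: t01 => t0 _; rewrite normrZ (gtr0_norm t0) /t divfK ?gt_eqF.
have [[x0 Kx0]|Kempty] := pselect (K !=set0); last first.
  by exists 1 => // x xfin /(proj _ xfin)[z Kz]; case: Kempty; exists z.
(* [lsc_attains_min] with [f = 0], which is finite everywhere. *)
have [x1 [Kx1 _ x1min]] : exists x, [/\ K x, (0 < +oo :> \bar R)%E &
    forall z, K z -> (0 < +oo :> \bar R)%E -> 0 + rbregman x y <= 0 + rbregman z y].
  apply: (@lsc_attains_min _ _ (cst 0%E)); last by exists x0 => //; rewrite ltry.
  - by move=> x a ax; exists setT => //; exact: filterT.
  - by move=> x; rewrite ltNyr.
  - apply: (@shell_compact _ _ y s (set1 s)) => [|a ->//].
    exact: closed_eq.
  by move=> x /KU; exact: rbregman_continuous.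
have x10 : 0 < rbregman x1 y.
  apply: rbregman_gt0 => //; first exact: int_edom (KU _ Kx1).
  apply/eqP => x1y; move: Kx1 s0; rewrite /K /= x1y subrr normr0 => <-.
  by rewrite ltxx.
exists (rbregman x1 y / s); first by rewrite divr_gt0.
move=> x xfin /(proj _ xfin)[z Kz hz].
rewrite mulrAC ler_pdivrMr // [rbregman x y * s]mulrC; apply: le_trans hz.
by rewrite mulrC ler_wpM2l //; have := x1min _ Kz (ltry _); rewrite !add0r.
Qed.

Lemma bregmanE x y : (edom phi)° y -> (phi x < +oo)%E ->
  bregman phi x y = (rbregman x y)%:E.
Proof.
move=> Uy xfin; rewrite /bregman asboolT // (phi_fine _ xfin).
by rewrite (phi_fine _ (int_edom _ Uy)).
Qed.

Lemma bregman_pinfty x y :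
  (edom phi)° y -> phi x = +oo%E -> bregman phi x y = +oo%E.
Proof.
move=> Uy xinf; rewrite /bregman asboolT // xinf.
by rewrite (phi_fine _ (int_edom _ Uy)).
Qed.

(** * Tilted minimizers and their stability *)

(** The left proximal mapping in the dual variable [w = grad phi y]
    ([left_proxE]). This form makes sense for every [w], and the function
    being minimized is affine in [w]. *)
Definition tilted_argmin (lambda : R) (f : 'rV[R]_m -> \bar R) w : set 'rV[R]_m :=
  [set x | [/\ (f x < +oo)%E, (phi x < +oo)%E &
    forall z, (f z < +oo)%E -> (phi z < +oo)%E ->
      fine (f x) + lambda^-1 * (fine (phi x) - dotp w x) <=
      fine (f z) + lambda^-1 * (fine (phi z) - dotp w z)]].

Lemma left_proxE lambda (f : 'rV[R]_m -> \bar R) y :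
  (forall x, (-oo < f x)%E) -> 0 < lambda -> (edom phi)° y ->
  left_prox phi lambda f y = tilted_argmin lambda f (grad phi y).
Proof.
move=> f_gt l0 Uy; rewrite /left_prox /argmin.
pose F x := (f x + lambda^-1%:E * bregman phi x y)%E.
have Ffin x : (f x < +oo)%E -> (phi x < +oo)%E ->
    F x = (fine (f x) + lambda^-1 * rbregman x y)%:E.
  move=> xf xphi.
  by rewrite /F bregmanE // {1}(fineK_lt _ _ (f_gt x) xf) -EFinM -EFinD.
have Finf x : ~ ((f x < +oo)%E /\ (phi x < +oo)%E) -> F x = +oo%E.
  have [xf|] := ltP (f x) +oo%E; last first.
    rewrite leye_eq => /eqP xf _; rewrite /F xf addye //.
    have [xphi|] := ltP (phi x) +oo%E; first by rewrite bregmanE.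
    rewrite leye_eq => /eqP xphi; rewrite bregman_pinfty //.
    by rewrite gt0_muley // lte_fin invr_gt0.
  have [xphi h|] := ltP (phi x) +oo%E; first by case: h.
  rewrite leye_eq => /eqP xphi _; rewrite /F bregman_pinfty //.
  by rewrite gt0_muley ?lte_fin ?invr_gt0 // (fineK_lt _ _ (f_gt x) xf).
have Fle x z : (F x < +oo)%E -> (f z < +oo)%E -> (phi z < +oo)%E -> (F x <= F z)%E =
    (fine (f x) + lambda^-1 * (fine (phi x) - dotp (grad phi y) x) <=
     fine (f z) + lambda^-1 * (fine (phi z) - dotp (grad phi y) z)).
  move=> Fx zf zphi.
  have [[xf xphi]|/Finf xinf] := pselect ((f x < +oo)%E /\ (phi x < +oo)%E);
    last first.
    by rewrite xinf in Fx.
  rewrite !Ffin // lee_fin /rbregman !dotpBr; apply/idP/idP; lra.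
apply/seteqP; split => x /=.
  move=> [Fx xmin].
  have [[xf xphi]|/Finf xinf] := pselect ((f x < +oo)%E /\ (phi x < +oo)%E);
    last first.
    by rewrite -/(F x) xinf in Fx.
  by split=> // z zf zphi; rewrite -Fle //; exact: xmin.
move=> [xf xphi xmin]; have Fx : (F x < +oo)%E by rewrite Ffin // ltry.
split=> // z; rewrite -/(F x) -/(F z).
have [[zf zphi]|/Finf ->] := pselect ((f z < +oo)%E /\ (phi z < +oo)%E).
  by rewrite Fle //; exact: xmin.
by rewrite leey.
Qed.

(** The growth hypothesis gives the tilted function at
    [w0 = grad phi x0 + lambda *: v] an excess over its value at [x0] of at least
    [(lambda^-1 - r) * rbregman x x0], which is linear in [`|x - x0|] outside a
    ball. Passing from [w0] to [w] subtracts
    [lambda^-1 * dotp (w - w0) (x - x0)], so for [w] near [w0] every point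
    outside the ball is worse than [x0], while a minimum is attained inside. *)
Lemma tilted_argmin_stable lambda r (f : 'rV[R]_m -> \bar R) x0 v
    (N : set 'rV[R]_m) :
  lower_semicontinuous f -> (forall x, (-oo < f x)%E) ->
  (edom phi)° x0 -> (f x0 < +oo)%E -> 0 < lambda -> lambda * r < 1 ->
  (forall x, (f x < +oo)%E -> (phi x < +oo)%E ->
    fine (f x0) + dotp v (x - x0) - r * rbregman x x0 <= fine (f x)) ->
  nbhs x0 N ->
  \forall w \near (grad phi x0 + lambda *: v),
    tilted_argmin lambda f w !=set0 /\ tilted_argmin lambda f w `<=` N.
Proof.
move=> f_lsc f_gt Ux0 x0f l0 lr growth Nx0; set w0 := _ + _.
have x0phi := int_edom _ Ux0.
have [rho rho0 near_x0] := (nbhs_distP _ _).1 (filterI (near_int_edom _ Ux0) Nx0).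
pose d := rho / 2; have d0 : 0 < d by rewrite divr_gt0.
have drho : d < rho by rewrite /d; lra.
have [a a0 agrowth] := rbregman_growth _ _ Ux0 d0.
(* [m.+1] instead of the constant [m] of [dotp_le], which may be zero. *)
pose eta := (1 - lambda * r) * a / m.+1%:R.
have eta0 : 0 < eta by rewrite divr_gt0 // mulr_gt0 // subr_gt0.
apply: (nbhs_distP _ _).2; exists eta => // w ww0.
pose T x := fine (f x) + lambda^-1 * (fine (phi x) - dotp w x).
have far x : (f x < +oo)%E -> (phi x < +oo)%E -> d <= `|x - x0| -> T x0 < T x.
  move=> xf xphi dx; have n0 : 0 < `|x - x0| by apply: lt_le_trans dx.
  have h1 := growth _ xf xphi; have h2 := agrowth _ xphi dx.
  have h3 : dotp (w - w0) (x - x0) < (1 - lambda * r) * rbregman x x0.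
    apply: le_lt_trans (ler_norm _) _; apply: le_lt_trans (dotp_le _ _) _.
    apply: (@lt_le_trans _ _ ((1 - lambda * r) * (a * `|x - x0|))); last first.
      by rewrite ler_wpM2l // subr_ge0 ltW.
    rewrite mulrA ltr_pM2r //.
    apply: (@le_lt_trans _ _ (m.+1%:R * `|w - w0|)).
      by rewrite ler_wpM2r // ler_nat.
    by rewrite mulrC -ltr_pdivlMr.
  rewrite -subr_gt0.
  have -> : T x - T x0 = (fine (f x) - fine (f x0)) + lambda^-1 *
      (rbregman x x0 - dotp (w - w0) (x - x0) - lambda * dotp v (x - x0)).
    by rewrite /T /w0 /rbregman !dotpBl !dotpDl !dotpZl !dotpBr; ring.
  rewrite -(ltr_pM2l l0) mulr0 mulrDr mulrA divff ?gt_eqF // mul1r.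
  have := ler_wpM2l (ltW l0) h1; lra.
split; last first.
  move=> x [xf xphi xmin]; suff /near_x0[] : `|x - x0| < rho by [].
  apply: lt_trans drho; rewrite ltNge; apply/negP => /(far _ xf xphi).
  by rewrite ltNge xmin.
pose K := [set x : 'rV[R]_m | `|x - x0| <= d].
have KU x : K x -> (edom phi)° x.
  by move=> Kx; have [] // := near_x0 x; exact: le_lt_trans Kx _.
have [x1 [Kx1 x1f x1min]] : exists x, [/\ K x, (f x < +oo)%E &
    forall z, K z -> (f z < +oo)%E -> T x <= T z].
  apply: (@lsc_attains_min _ _ f
    (fun x => lambda^-1 * (fine (phi x) - dotp w x))) => //.
  - by apply: (@shell_compact _ _ x0 d [set a : R | a <= d]) => //;
      exact: closed_le.
  - move=> x /KU Ux.
    apply: (@cvgMl_tmp _ _ (nbhs x)); apply: (@cvgB _ _ _ (nbhs x)).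
      exact: differentiable_continuous (phi_diff _ Ux).
    by apply: (@cvg_dotp _ _ _ (nbhs x)); [exact: cvg_cst|exact: cvg_id].
  - by exists x0 => //; rewrite /K /= subrr normr0 ltW.
exists x1; split => //; first exact: int_edom (KU _ Kx1).
move=> z zf zphi; have [Kz|dz] := leP `|z - x0| d; first exact: x1min.
apply: (@le_trans _ _ (T x0)); last by apply: ltW; apply: far => //; exact: ltW.
by apply: x1min => //; rewrite /K /= subrr normr0 ltW.
Qed.

(** Fermat's rule: the smooth part of the tilted function moves to the other
    side with its gradient. *)
Lemma tilted_argmin_subgrad lambda (f : 'rV[R]_m -> \bar R) w x :
  (forall x, (-oo < f x)%E) -> 0 < lambda -> (edom phi)° x ->
  tilted_argmin lambda f w x ->
  regular_subdiff f x (lambda^-1 *: (w - grad phi x)).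
Proof.
move=> f_gt l0 Ux [xf xphi xmin]; rewrite /regular_subdiff /=.
rewrite (fineK_lt _ _ (f_gt x) xf); split=> // e e0.
have le0 : 0 < lambda * e by rewrite mulr_gt0.
have near_x := filterI (near_int_edom _ Ux)
  (grad_expansion _ _ _ (phi_diff _ Ux) le0).
near=> z; have [Uz hz] : (edom phi)° z /\
    `|fine (phi z) - fine (phi x) - dotp (grad phi x) (z - x)| <=
    lambda * e * `|z - x|.
  by near: z; exact: near_x.
have [zf|] := ltP (f z) +oo%E; last by rewrite leye_eq => /eqP ->; rewrite leey.
have h1 := xmin z zf (int_edom _ Uz).
have h2 := ler_wpM2l (ltW e0) (norm_le_enorm (z - x)).
move: hz; rewrite ler_norml => /andP[_ hz].
have k0 : 0 <= lambda^-1 by rewrite invr_ge0 ltW.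
have := ler_wpM2l k0 hz; rewrite -!mulrA mulKf ?gt_eqF // => h3.
rewrite (fineK_lt _ _ (f_gt z) zf) -EFinD lee_fin dotpZl dotpBl.
rewrite !dotpBr in h3 *; lra.
Unshelve. all: by end_near. Qed.

(** * The gradient as a local homeomorphism *)

(** Fermat's rule thereby reads [grad phi x = w] when [f] is constant. *)
Lemma regular_subdiff_cst (c : R) x u :
  regular_subdiff (fun _ : 'rV[R]_m => c%:E) x u -> u = 0.
Proof.
move=> [_ ux]; apply/eqP; rewrite -normr_le0.
apply: le_trans (norm_le_enorm _) _; rewrite -sqrtr0 ler_sqrt //.
apply/ler_addgt0Pr => e e0; rewrite add0r.
have d0 : 0 < e / (m%:R * `|u| + 1) by rewrite divr_gt0 // ltr_wpDl // mulr_ge0.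
have [t /andP[t0 t1]] := segment_near (x + u) x _ (ux _ d0).
rewrite /= (_ : t *: (x + u) + _ - x = t *: u); last first.
  by apply/rowP => i; rewrite !mxE; ring.
rewrite -EFinD lee_fin dotpZr => h'.
have h : t * dotp u u <= e / (m%:R * `|u| + 1) * enorm (t *: u) by lra.
rewrite -(ler_pM2l t0); apply: le_trans h _.
apply: le_trans (ler_wpM2l (ltW d0) (enorm_le _)) _.
rewrite normrZ (gtr0_norm t0) mulrAC ler_pdivrMr ?ltr_wpDl ?mulr_ge0 //.
by rewrite !mulrDr mulr1; have := mulr_gt0 t0 e0; lra.
Qed.

(** The minimizers of [phi - <w, .>] are the solutions of [grad phi y = w], and
    by stability they exist near [y0] for all [w] near [grad phi y0]. *)
Lemma grad_open y0 (N : set 'rV[R]_m) : (edom phi)° y0 -> nbhs y0 N ->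
  \forall w \near grad phi y0, exists y, [/\ N y, (edom phi)° y & grad phi y = w].
Proof.
move=> Uy0 Ny0.
have near_y : \forall w \near grad phi y0,
    tilted_argmin 1 (cst 0%E) w !=set0 /\
    tilted_argmin 1 (cst 0%E) w `<=` (edom phi)° `&` N.
  rewrite -[grad phi y0]addr0 -[X in _ + X](scaler0 _ 1).
  apply: (@tilted_argmin_stable 1 0) => //;
    last exact: filterI (near_int_edom _ Uy0) Ny0.
  - by move=> x a ax; exists setT => //; exact: filterT.
  - by move=> x; rewrite ltNyr.
  - exact: ltry.
  - by move=> x _ _; rewrite dotp0l mul0r addr0 subr0.
apply: (@filterS _ (nbhs (grad phi y0)) _ _ _ _ near_y).
move=> w [[y ymin] /(_ _ ymin)[Uy Ny]]; exists y; split=> //.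
have := tilted_argmin_subgrad _ _ _ _ _ ltr01 Uy ymin.
move=> /(_ (fun=> ltNyr _))/regular_subdiff_cst.
by rewrite invr1 scale1r => /eqP; rewrite subr_eq0 => /eqP.
Qed.

Lemma conjugate_grad y : (edom phi)° y ->
  conjugate phi (grad phi y) = (dotp (grad phi y) y - fine (phi y))%:E.
Proof.
move=> Uy; have yfin := int_edom _ Uy; apply/eqP; rewrite eq_le; apply/andP; split.
  apply: ge_ereal_sup => _ [x _ <-].
  have [xfin|] := ltP (phi x) +oo%E;
    last by rewrite leye_eq => /eqP ->; rewrite leNye.
  rewrite (phi_fine _ xfin) -EFinB lee_fin.
  by have := rbregman_ge0 _ _ Uy xfin; rewrite /rbregman dotpBr; lra.
by apply: ereal_sup_ubound; exists y => //; rewrite {1}(phi_fine _ yfin) -EFinB.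
Qed.

(** Let [grad phi y = w] with [w] near [w0 = grad phi y0]. The two inequalities
    [rbregman y y0 >= 0] and [rbregman y0 y >= 0] enclose the increment of the
    conjugate from [w0] to [w] between [<w - w0, y0>] and [<w - w0, y>], and [y]
    tends to [y0] as [w] tends to [w0] by [grad_open]. *)
Lemma grad_conjugate y0 :
  (edom phi)° y0 -> grad (conjugate phi) (grad phi y0) = y0.
Proof.
move=> Uy0; apply/rowP => i; rewrite mxE; apply: cvg_lim => //.
apply/cvgrPdist_le => /= e e0.
have Ny0 : \forall y \near y0, `|y - y0| < e by apply: (nbhs_distP _ _).2; exists e.
have near_w := grad_open _ _ Uy0 Ny0.
have line : (h *: delta_mx 0 i + grad phi y0) @[h --> (0 : R)] --> grad phi y0.
  rewrite -[X in _ --> X]add0r -(scale0r (delta_mx 0 i)).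
  by apply: cvgD; [apply: cvgZr_tmp; exact: cvg_id|exact: cvg_cst].
have := line _ near_w; rewrite /= => near_h.
near=> h.
have h0 : h != 0 by near: h; exact: nbhs_dnbhs_neq.
have [y [Ny Uy yw]] : exists y, [/\ `|y - y0| < e, (edom phi)° y &
    grad phi y = h *: delta_mx 0 i + grad phi y0].
  by near: h; exact: (@nbhs_dnbhs R 0 _ near_h).
rewrite -yw !conjugate_grad // /=.
set q := _ *: _.
have hq : h * q = dotp (grad phi y) y - fine (phi y) -
    (dotp (grad phi y0) y0 - fine (phi y0)).
  by rewrite /q /GRing.scale /= mulrA divff // mul1r.
have yi : `|(y - y0) 0 i| < e by apply: le_lt_trans (norm_coord_le _ _) Ny.
have g1 := rbregman_ge0 _ _ Uy0 (int_edom _ Uy).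
have g2 := rbregman_ge0 _ _ Uy (int_edom _ Uy0).
rewrite /rbregman yw !dotpBr !dotpDl !dotpZl in g1 g2.
rewrite ![dotp (delta_mx _ _) _]dotpC !dotp_delta in g1 g2.
rewrite yw dotpDl dotpZl [dotp (delta_mx _ _) _]dotpC dotp_delta in hq.
rewrite -(ler_pM2l (_ : 0 < `|h|)) ?normr_gt0 // -normrM mulrBr hq.
apply: (@le_trans _ _ `|h * (y - y0) 0 i|); last first.
  by rewrite normrM ler_wpM2l // ltW.
have hy0 : 0 <= h * (y 0 i - y0 0 i) by lra.
by rewrite !mxE (ger0_norm hy0) ler_norml; apply/andP; split; lra.
Unshelve. all: by end_near. Qed.

(** * Proximal subgradients and resolvents of localizations *)

(** Prox-boundedness bounds [f] from below by a constant minus a multiple of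
    [bregman phi x y1], which differs from the same multiple of
    [bregman phi x x0] by an affine function of [x]. Away from [x0] the linear
    growth of the distance to [x0] absorbs this affine function and the affine
    minorant on the left-hand side. *)
Lemma rel_prox_subgrad_global (f : 'rV[R]_m -> \bar R) x0 v :
  (forall x, (-oo < f x)%E) -> prox_bounded phi f -> rel_prox_subgrad phi f x0 v ->
  exists2 r, 0 < r & forall x, (f x < +oo)%E -> (phi x < +oo)%E ->
    fine (f x0) + dotp v (x - x0) - r * rbregman x x0 <= fine (f x).
Proof.
move=> f_gt [lambda [l0 [y1 [Uy1 /ereal_between[c [_ c_env]]]]]].
move=> [Ux0 x0f [r0 [e [r00 e0 local]]]].
have [d d0 near_x0] : exists2 d, 0 < d &
    forall x : 'rV[R]_m, `|x - x0| < d -> enorm (x - x0) < e.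
  by apply: (nbhs_distP _ _).1; apply: (nbhs_enormP _ _).2; exists e.
have [a a0 growth] := rbregman_growth _ _ Ux0 d0.
pose u := v + lambda^-1 *: (grad phi x0 - grad phi y1).
pose k := fine (f x0) - c + lambda^-1 * rbregman x0 y1.
pose b := `|k| / d + m%:R * `|u|.
have b0 : 0 <= b by rewrite addr_ge0 ?mulr_ge0 ?invr_ge0 // ltW.
have l'0 : 0 <= lambda^-1 by rewrite invr_ge0 ltW.
have ba0 : 0 <= b / a by rewrite divr_ge0 // ltW.
exists (r0 + lambda^-1 + b / a) => [|x xf xphi]; first by lra.
have gap0 := rbregman_ge0 _ _ Ux0 xphi.
have [xd|dx] := ltP `|x - x0| d.
  have [_] := local x (ltW (near_x0 _ xd)).
  rewrite bregmanE // (fineK_lt _ _ (f_gt x) xf) -(fineK x0f).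
  rewrite -EFinM -EFinD lee_fin /=.
  have := mulr_ge0 (addr_ge0 l'0 ba0) gap0; lra.
have n0 : 0 < `|x - x0| by apply: lt_le_trans dx.
have h1 : c <= fine (f x) + lambda^-1 * rbregman x y1.
  rewrite -lee_fin; apply: le_trans (ltW c_env) _.
  apply: ereal_inf_lbound; exists x => //.
  by rewrite bregmanE // {1}(fineK_lt _ _ (f_gt x) xf) -EFinM -EFinD.
have h2 : k + dotp u (x - x0) <= b * `|x - x0|.
  rewrite mulrDl lerD //.
    apply: le_trans (ler_norm _) _.
    by rewrite mulrAC ler_pdivlMr // ler_wpM2l.
  by apply: le_trans (ler_norm _) _; exact: dotp_le.
have h3 : b * `|x - x0| <= b / a * rbregman x x0.
  by rewrite -mulrA ler_wpM2l // ler_pdivlMl // growth.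
have h4 : rbregman x y1 = rbregman x x0 + rbregman x0 y1 +
    dotp (grad phi x0 - grad phi y1) (x - x0).
  by rewrite /rbregman !dotpBl !dotpBr; ring.
rewrite h4 in h1; rewrite /u /k dotpDl dotpZl in h2.
have := mulr_ge0 (ltW r00) gap0; lra.
Qed.

(** Only [f]-attentiveness is not immediate from continuity: comparing the
    minimizer [x] with [x0] and using convexity of [phi] gives
    [f x <= f x0 + lambda^-1 * dotp (w - grad phi x0) (x - x0)], whose last term
    tends to [0] as [x] tends to [x0]. *)
Lemma tilted_argmin_localization lambda (f : 'rV[R]_m -> \bar R) x0 v e :
  (forall x, (-oo < f x)%E) -> (edom phi)° x0 -> (f x0 < +oo)%E ->
  0 < lambda -> 0 < e ->
  exists2 N : set 'rV[R]_m, nbhs x0 N &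
    \forall w \near (grad phi x0 + lambda *: v), forall x, N x ->
      tilted_argmin lambda f w x ->
      (edom phi)° x /\
      attentive_localization f x0 v e x (lambda^-1 *: (w - grad phi x)).
Proof.
move=> f_gt Ux0 x0f l0 e0; set w0 := _ + _.
have k0 : 0 <= lambda^-1 by rewrite invr_ge0 ltW.
pose F := filter_prod (nbhs w0) (nbhs x0).
have cw : p.1 @[p --> F] --> w0 by exact: cvg_fst.
have cx : p.2 @[p --> F] --> x0 by exact: cvg_snd.
have cg : grad phi p.2 @[p --> F] --> grad phi x0.
  exact: cvg_comp cx (grad_continuous _ Ux0).
have c1 : lambda^-1 *: (p.1 - grad phi p.2) @[p --> F] --> v.
  have -> : v = lambda^-1 *: (w0 - grad phi x0).
    by rewrite /w0 addrC addKr scalerA mulVf ?gt_eqF // scale1r.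
  by apply: cvgZl_tmp; apply: cvgB.
have c2 : lambda^-1 * dotp (p.1 - grad phi x0) (p.2 - x0) @[p --> F] --> (0 : R).
  have -> : 0 = lambda^-1 * dotp (w0 - grad phi x0) (x0 - x0) :> R.
    by rewrite subrr dotpC dotp0l mulr0.
  by apply: cvgMl_tmp; apply: cvg_dotp; apply: cvgB => //; exact: cvg_cst.
have n1 : \forall p \near F, enorm (lambda^-1 *: (p.1 - grad phi p.2) - v) < e.
  by apply: (c1 [set u | enorm (u - v) < e]); apply: (nbhs_enormP _ _).2; exists e.
have n2 : \forall p \near F, lambda^-1 * dotp (p.1 - grad phi x0) (p.2 - x0) < e.
  exact: (cvgr_lt _ c2).
have n3 : \forall p \near F, enorm (p.2 - x0) < e /\ (edom phi)° p.2.
  apply: (cx [set x | enorm (x - x0) < e /\ (edom phi)° x]).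
  apply: filterI; last exact: near_int_edom.
  by apply: (nbhs_enormP _ _).2; exists e.
have [[W N] /= [Ww0 Nx0] WN] := filterI n1 (filterI n2 n3).
exists N => //; apply: (@filterS _ (nbhs w0) _ W) => // w Ww x Nx xmin.
have [/= h1 [h2 [h3 Ux]]] := WN (w, x) (conj Ww Nx).
split => //; split => //.
  by apply: regular_limiting; exact: tilted_argmin_subgrad.
have [xf xphi /(_ x0 x0f (int_edom _ Ux0)) hmin] := xmin.
rewrite (fineK_lt _ _ (f_gt x) xf) (fineK_lt _ _ (f_gt x0) x0f) -EFinD lte_fin.
have := ler_wpM2l k0 (rbregman_ge0 _ _ Ux0 xphi); rewrite /rbregman.
rewrite dotpBl !dotpBr in h2 *; lra.
Qed.

Lemma resolventE lambda (T : 'rV[R]_m -> set 'rV[R]_m) y :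
  0 < lambda -> (edom phi)° y ->
  sv_comp (sv_inv (sv_add (grad_map phi) (sv_scale lambda T))) (grad_map phi) y =
  [set x | (edom phi)° x /\ T x (lambda^-1 *: (grad phi y - grad phi x))].
Proof.
move=> l0 Uy; apply/seteqP; split => x /=.
  move=> [_ [_ ->]] [_ [_ [[Ux ->] [v Tv <-] ->]]]; split=> //.
  by rewrite addrC addKr scalerA mulVf ?gt_eqF // scale1r.
move=> [Ux Tx]; exists (grad phi y) => //=.
exists (grad phi x), (grad phi y - grad phi x); split=> //;
  last by rewrite addrC subrK.
exists (lambda^-1 *: (grad phi y - grad phi x)) => //.
by rewrite scalerA divff ?gt_eqF // scale1r.
Qed.

Lemma rbregman_sum x y :
  rbregman x y + rbregman y x = dotp (grad phi x - grad phi y) (x - y).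
Proof. by rewrite /rbregman !dotpBl !dotpBr; ring. Qed.

(** The two values of [T] differ by [- lambda^-1] times the difference of the
    gradients. Monotonicity then makes [(lambda * r - 1)] times the symmetrized
    Bregman distance of [x1] and [x2] nonnegative, although that distance is
    positive for distinct points. *)
Lemma resolvent_unique lambda r (T : 'rV[R]_m -> set 'rV[R]_m) w x1 x2 :
  0 < lambda -> lambda * r < 1 ->
  monotone_map (sv_add T (sv_scale r (grad_map phi))) ->
  (edom phi)° x1 -> T x1 (lambda^-1 *: (w - grad phi x1)) ->
  (edom phi)° x2 -> T x2 (lambda^-1 *: (w - grad phi x2)) -> x1 = x2.
Proof.
move=> l0 lr Tmono Ux1 Tx1 Ux2 Tx2; apply/eqP/negP => /negP x12.
have g12 := rbregman_gt0 _ _ Ux2 (int_edom _ Ux1) x12.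
have g21 := rbregman_gt0 _ _ Ux1 (int_edom _ Ux2); rewrite eq_sym x12 in g21.
have := Tmono x1 x2 (lambda^-1 *: (w - grad phi x1) + r *: grad phi x1)
  (lambda^-1 *: (w - grad phi x2) + r *: grad phi x2).
have diff (g1 g2 : 'rV[R]_m) :
    lambda^-1 *: (w - g1) + r *: g1 - (lambda^-1 *: (w - g2) + r *: g2) =
    (r - lambda^-1) *: (g1 - g2).
  by apply/rowP => i; rewrite !mxE; ring.
have mem x u : (edom phi)° x -> T x u ->
    sv_add T (sv_scale r (grad_map phi)) x (u + r *: grad phi x).
  by move=> Ux Tu; exists u, (r *: grad phi x); split=> //; exists (grad phi x).
move=> /(_ (mem _ _ Ux1 Tx1) (mem _ _ Ux2 Tx2)).
rewrite diff.
rewrite dotpZl -rbregman_sum -(ler_pM2l l0) mulr0 mulrA mulrBr divff ?gt_eqF //.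
have : 0 < (1 - lambda * r) * (rbregman x1 x2 + rbregman x2 x1).
  by rewrite mulr_gt0 ?subr_gt0 // addr_gt0 // g21.
lra.
Qed.

(** * From prox-regularity to single-valued proximal mappings and back *)

Lemma prox_regular_proximal (f : 'rV[R]_m -> \bar R) xbar vbar :
  rel_prox_regular phi f xbar vbar -> rel_prox_subgrad phi f xbar vbar.
Proof.
move=> [Uxbar xf _ vsub [e [r [e0 r0 eU reg]]]]; split=> //.
exists (r + 1), (e / 2); split; [by rewrite ltr_wpDl|by rewrite divr_gt0|].
move=> x xe; have xe' : enorm (x - xbar) < e by apply: le_lt_trans xe _; lra.
have Ux := eU _ xe'; split=> //.
have enorm0 (u : 'rV[R]_m) : enorm (u - u) = 0.
  by rewrite subrr /enorm dotp0l sqrtr0.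
have := reg xbar x vbar xe' _ _ vsub.
rewrite !enorm0 subee // lte_fin => /(_ e0 e0 e0).
rewrite bregmanE ?int_edom // -(fineK xf) -!EFinM -!EFinD.
apply: le_trans; rewrite lee_fin.
by have := rbregman_ge0 _ _ Uxbar (int_edom _ Ux); lra.
Qed.

(** The inequality for [x] and [u] evaluated at [y], added to the one for [y] and
    [v] evaluated at [x], is the monotonicity inequality by [rbregman_sum]. *)
Lemma prox_regular_monotone (f : 'rV[R]_m -> \bar R) xbar vbar :
  rel_prox_regular phi f xbar vbar ->
  exists e r : R, [/\ 0 < e, 0 < r &
    monotone_map (sv_add (attentive_localization f xbar vbar e)
                         (sv_scale r (grad_map phi)))].
Proof.
move=> [Uxbar xf _ vsub [e [r [e0 r0 eU reg]]]].
exists e, (r + 1); split=> //; first by rewrite ltr_wpDl.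
move=> x y x' y' [u [x2 [[usub uv ux fx] [gx [Ux ->] <-] ->]]].
move=> [v [y2 [[vsub' vv vy fy] [gy [Uy ->] <-] ->]]].
have xfin := usub.1; have yfin := vsub'.1.
have := reg y x v ux vy _ vsub' vv; have := reg x y u vy ux _ usub uv.
rewrite !bregmanE ?int_edom // -(fineK xf) -(fineK xfin) -(fineK yfin).
rewrite -(fineK xf) -(fineK xfin) in fx; rewrite -(fineK xf) -(fineK yfin) in fy.
rewrite -!EFinM -!EFinD !lee_fin !lte_fin in fx fy *.
move=> h1 h2.
have -> : u + (r + 1) *: grad phi x - (v + (r + 1) *: grad phi y) =
    (u - v) + (r + 1) *: (grad phi x - grad phi y).
  by rewrite opprD addrACA scalerBr.
rewrite dotpDl dotpZl -rbregman_sum dotpBl !dotpBr.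
rewrite !dotpBr in h1 h2.
have := rbregman_ge0 _ _ Ux (int_edom _ Uy).
have := rbregman_ge0 _ _ Uy (int_edom _ Ux).
lra.
Qed.

(** Together with [grad_conjugate], this identifies the base point [ybar] of the
    proximal mapping as an interior point of the domain. *)
Lemma grad_shift x0 v : (edom phi)° x0 ->
  exists2 l0 : R, 0 < l0 & forall lambda, 0 < lambda -> lambda < l0 ->
    exists2 y, (edom phi)° y & grad phi y = grad phi x0 + lambda *: v.
Proof.
move=> Ux0.
have [rho rho0 near_w] := (nbhs_distP _ _).1 (grad_open _ setT Ux0 filterT).
exists (rho / (`|v| + 1)) => [|lambda l0 lrho].
  by rewrite divr_gt0 // ltr_wpDl.
have [|y [_ Uy yw]] := near_w (grad phi x0 + lambda *: v); last by exists y.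
rewrite addrC addKr normrZ gtr0_norm //.
rewrite ltr_pdivlMr ?ltr_wpDl // mulrDr mulr1 in lrho; lra.
Qed.

(** Near [y0] the proximal set is nonempty by stability and lies in the
    resolvent by localization; the resolvent has at most one point, so both are
    the same singleton. *)
Lemma proximal_monotone_left_prox (f : 'rV[R]_m -> \bar R) xbar vbar e rp rm
    lambda y0 :
  lower_semicontinuous f -> (forall x, (-oo < f x)%E) ->
  (edom phi)° xbar -> (f xbar < +oo)%E ->
  (forall x, (f x < +oo)%E -> (phi x < +oo)%E ->
    fine (f xbar) + dotp vbar (x - xbar) - rp * rbregman x xbar <= fine (f x)) ->
  0 < e ->
  monotone_map (sv_add (attentive_localization f xbar vbar e)
                       (sv_scale rm (grad_map phi))) ->
  0 < lambda -> lambda * rp < 1 -> lambda * rm < 1 ->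
  (edom phi)° y0 -> grad phi y0 = grad phi xbar + lambda *: vbar ->
  [/\ single_valued_near (left_prox phi lambda f) y0,
      left_prox phi lambda f y0 = [set xbar] &
      \forall y \near y0, left_prox phi lambda f y =
        sv_comp (sv_inv (sv_add (grad_map phi)
          (sv_scale lambda (attentive_localization f xbar vbar e))))
          (grad_map phi) y].
Proof.
move=> f_lsc f_gt Uxbar xf growth e0 Tmono l0 lrp lrm Uy0 y0w.
have [N Nxbar locN] := tilted_argmin_localization _ _ _ vbar _ f_gt Uxbar xf l0 e0.
have stable := tilted_argmin_stable _ _ _ _ _ _
  f_lsc f_gt Uxbar xf l0 lrp growth Nxbar.
have main : \forall y \near y0, (exists x, left_prox phi lambda f y = [set x]) /\
    left_prox phi lambda f y =
        sv_comp (sv_inv (sv_add (grad_map phi)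
          (sv_scale lambda (attentive_localization f xbar vbar e))))
          (grad_map phi) y.
  rewrite -y0w in locN stable.
  have nearw := @filterI _ _ (nbhs_filter (grad phi y0)) _ _ locN stable.
  have near_y := @filterI _ _ (nbhs_filter y0) _ _
    (near_int_edom _ Uy0) (grad_continuous _ Uy0 _ nearw).
  apply: (@filterS _ (nbhs y0) _ _ _ _ near_y) => y [Uy [loc [[x xmin] subN]]].
  rewrite resolventE // left_proxE //.
  have sub z : tilted_argmin lambda f (grad phi y) z -> (edom phi)° z /\
      attentive_localization f xbar vbar e z
        (lambda^-1 *: (grad phi y - grad phi z)).
    by move=> zmin; apply: loc => //; exact: subN.
  have uniq z : (edom phi)° z ->
      attentive_localization f xbar vbar e z
        (lambda^-1 *: (grad phi y - grad phi z)) ->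
      z = x.
    move=> Uz Tz; have [Ux Tx] := sub _ xmin.
    exact: resolvent_unique l0 lrm Tmono Uz Tz Ux Tx.
  split; first exists x.
    by apply/seteqP; split=> z /= => [/sub[Uz Tz]|->//]; exact: uniq.
  by apply/seteqP; split=> z /= => [/sub//|[Uz Tz]]; rewrite (uniq z).
have single : single_valued_near (left_prox phi lambda f) y0.
  by apply: (@filterS _ (nbhs y0) _ _ _ _ main) => y [].
split=> //; last by apply: (@filterS _ (nbhs y0) _ _ _ _ main) => y [].
have [x xE] := nbhs_singleton single.
suff : left_prox phi lambda f y0 xbar by rewrite xE => ->.
rewrite left_proxE //; split=> //; first exact: int_edom.
move=> z zf zphi; rewrite y0w -(ler_pM2l l0) !mulrDr !mulrA divff ?gt_eqF // !mul1r.
have h1 := ler_wpM2l (ltW l0) (growth _ zf zphi).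
have h2 : 0 <= (1 - lambda * rp) * rbregman z xbar.
  by rewrite mulr_ge0 ?rbregman_ge0 // subr_ge0 ltW.
rewrite /rbregman !dotpDl !dotpZl !dotpBr in h1 h2 *; lra.
Qed.

(** Given [x] near [xbar] and [v] near [vbar], the vector
    [grad phi x + lambda *: v] is near [grad phi y0] and hence is a gradient
    [grad phi y] with [y] near [y0]. If [v] is a subgradient at [x], then [x] lies
    in the resolvent at [y], so it is a global minimizer, and its minimality
    rearranges into the prox-regularity inequality with constant
    [lambda^-1]. *)
Lemma left_prox_regular (f : 'rV[R]_m -> \bar R) xbar vbar e lambda y0 :
  lower_semicontinuous f -> (forall x, (-oo < f x)%E) ->
  (edom phi)° xbar -> f xbar \is a fin_num -> limiting_subdiff f xbar vbar ->
  0 < e -> 0 < lambda ->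
  (edom phi)° y0 -> grad phi y0 = grad phi xbar + lambda *: vbar ->
  (\forall y \near y0, left_prox phi lambda f y =
    sv_comp (sv_inv (sv_add (grad_map phi)
      (sv_scale lambda (attentive_localization f xbar vbar e)))) (grad_map phi) y) ->
  rel_prox_regular phi f xbar vbar.
Proof.
move=> f_lsc f_gt Uxbar xbarf vsub e0 l0 Uy0 y0w proxE.
split=> //; first exact: lsc_locally_lsc.
have near_w := grad_open _ _ Uy0 proxE.
pose F := filter_prod (nbhs vbar) (nbhs xbar).
have cv : p.1 @[p --> F] --> vbar by exact: cvg_fst.
have cx : p.2 @[p --> F] --> xbar by exact: cvg_snd.
have cw : (grad phi p.2 + lambda *: p.1) @[p --> F] --> grad phi y0.
  rewrite y0w; apply: cvgD; first exact: cvg_comp cx (grad_continuous _ Uxbar).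
  by apply: cvgZl_tmp.
have [[V X] /= [Vv Xx] VX] := cw _ near_w.
have [ev ev0 evV] := (nbhs_enormP _ _).1 Vv.
have [ex ex0 exX] := (nbhs_enormP _ _).1 (filterI Xx (near_int_edom _ Uxbar)).
exists (Num.min e (Num.min ev ex)), lambda^-1; split.
- by rewrite !lt_min e0 ev0.
- by rewrite invr_ge0 ltW.
- by move=> x; rewrite !lt_min => /and3P[_ _ /exX[]].
move=> x x' v; rewrite !lt_min => /and3P[_ _ /exX[_ Ux']] /and3P[xe _ /exX[Xx' Ux]].
move=> fx xsub /and3P[ve vev _].
have [y [yE Uy yw]] := VX (v, x) (conj (evV _ vev) Xx'); rewrite /= in yw.
have xf := xsub.1.
have [f'|] := ltP (f x') +oo%E; last by rewrite leye_eq => /eqP ->; rewrite leey.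
have : left_prox phi lambda f y x.
  rewrite yE resolventE //=; split=> //.
  rewrite yw addrC addKr scalerA mulVf ?gt_eqF // scale1r; split=> //.
  move: fx; rewrite -(fineK xbarf) -(fineK xf) -EFinD !lte_fin.
  by rewrite !lt_min => /and3P[h _ _]; lra.
rewrite left_proxE // => -[_ _ /(_ x' f' (int_edom _ Ux'))].
rewrite bregmanE ?int_edom // (fineK_lt _ _ (f_gt x') f') -(fineK xf).
rewrite -EFinM -!EFinD lee_fin /=.
move=> hmin; have h := ler_wpM2l (ltW l0) hmin; rewrite -(ler_pM2l l0); move: h.
rewrite !(mulrDr, mulrN) !mulrA divff ?gt_eqF // !mul1r yw.
rewrite /rbregman !dotpDl !dotpZl !dotpBr.
lra.
Qed.

End LegendreFunction.

Theorem theorem3p20 (R : realType) (m : nat)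
    (phi f : 'rV[R]_m -> \bar R) (xbar vbar : 'rV[R]_m)
    (phi_Gamma0 : Gamma0 phi) (phi_legendre : legendre phi)
    (phi_coercive : super_coercive phi)
    (f_proper : proper_efun f) (f_lsc : lower_semicontinuous f)
    (f_prox_bounded : prox_bounded phi f)
    (xbar_int : (edom phi)° xbar) (f_fin : f xbar \is a fin_num) :
  [<-> rel_prox_regular phi f xbar vbar;

       [/\ limiting_subdiff f xbar vbar,
           rel_prox_subgrad phi f xbar vbar &
           exists eps r : R, [/\ 0 < eps, 0 < r &
             monotone_map (sv_add (attentive_localization f xbar vbar eps)
                                  (sv_scale r (grad_map phi)))]];

       limiting_subdiff f xbar vbar /\
       exists2 lambda0 : R, 0 < lambda0 &
         forall lambda : R, 0 < lambda ->
           (lambda%:E < prox_threshold phi f)%E -> lambda < lambda0 ->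
           let ybar := grad (conjugate phi) (grad phi xbar + lambda *: vbar) in
           [/\ single_valued_near (left_prox phi lambda f) ybar,
               left_prox phi lambda f ybar = [set xbar] &
               exists2 eps : R, 0 < eps &
                 \forall y \near ybar,
                   left_prox phi lambda f y =
                   sv_comp (sv_inv (sv_add (grad_map phi)
                     (sv_scale lambda (attentive_localization f xbar vbar eps))))
                     (grad_map phi) y]].
Proof.
case: phi_Gamma0 => [[phi_gt _] _ phi_convex].
case: phi_legendre => [[_ phi_diff _] phi_strict].
case: f_proper => f_gt _.
have xbar_lt : (f xbar < +oo)%E by rewrite ltey_eq f_fin.
have [l1 l1_gt0 shift] :=
  grad_shift _ phi_gt phi_convex phi_diff phi_strict _ vbar xbar_int.
tfae.
- move=> reg; split; first by case: reg.
    exact: (prox_regular_proximal _ phi_gt phi_convex phi_diff).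
  exact: (prox_regular_monotone _ phi_gt phi_convex phi_diff).
- move=> [vbar_sub proximal [e [r [e_gt0 r_gt0 mono]]]]; split=> //.
  have [rp rp_gt0 growth] := rel_prox_subgrad_global _ phi_gt phi_convex phi_diff
    phi_strict _ _ _ f_gt f_prox_bounded proximal.
  exists (Num.min l1 (Num.min rp^-1 r^-1)).
    by rewrite !lt_min l1_gt0 !invr_gt0 rp_gt0.
  move=> lambda lambda_gt0 _; rewrite !lt_min => /and3P[lt_l1 lt_rp lt_r] ybar.
  have [y0 y0_int y0E] := shift _ lambda_gt0 lt_l1.
  have -> : ybar = y0 by rewrite /ybar -y0E (grad_conjugate _ phi_gt).
  have [||single at_y0 near_y0] :=
    proximal_monotone_left_prox _ phi_gt phi_convex phi_diff phi_strict
    _ _ _ _ _ _ lambda y0 f_lsc f_gt xbar_int xbar_lt growth e_gt0 mono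
    lambda_gt0 _ _ y0_int y0E.
  - by rewrite -ltr_pdivlMr // div1r.
  - by rewrite -ltr_pdivlMr // div1r.
  by split=> //; exists e.
- move=> [vbar_sub [l0 l0_gt0 resolvent]].
  have [l2 [l2_gt0 l2_env]] := f_prox_bounded.
  pose lambda := Num.min l0 (Num.min l1 l2) / 2.
  have lambda_gt0 : 0 < lambda by rewrite divr_gt0 // !lt_min l0_gt0 l1_gt0.
  have : lambda < Num.min l0 (Num.min l1 l2).
    by rewrite ltr_pdivrMr // ltr_pMr ?ltr1n // !lt_min l0_gt0 l1_gt0.
  rewrite !lt_min => /and3P[lt_l0 lt_l1 lt_l2].
  have lt_threshold : (lambda%:E < prox_threshold phi f)%E.
    apply: (@lt_le_trans _ _ l2%:E); first by rewrite lte_fin.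
    by apply: ereal_sup_ubound; exists l2.
  have [y0 y0_int y0E] := shift _ lambda_gt0 lt_l1.
  have [_ _ [e e_gt0]] := resolvent _ lambda_gt0 lt_threshold lt_l0.
  rewrite -y0E (grad_conjugate _ phi_gt) // => near_y0.
  exact: (left_prox_regular _ phi_gt phi_convex phi_diff phi_strict _ _ _ _ _ _
    f_lsc f_gt xbar_int f_fin vbar_sub e_gt0 lambda_gt0 y0_int y0E near_y0).
Qed.
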